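(* Let $K, M \ge 2$ be integers, $\mathcal{D} = \{0,1,\ldots,K-1\}$, $\mathcal{Y} = \{0,1,\ldots,M-1\}$, let $\mathcal{X}$ be a finite set, and let $\mathcal{Z} = \mathcal{D}\times\mathcal{Y}^{\mathcal{D}}\times\mathcal{X}$. Let $\succsim$ be a binary relation on $\Delta(\mathcal{Z})$. The following are equivalent: (1) $\succsim$ satisfies Completeness, Transitivity, Independence, Continuity and Irrelevance of Counterfactual Outcomes; (2) there exists a standard utility, i.e. a function $u:\mathcal{D}\times\mathcal{Y}\times\mathcal{X}\to\mathbb{R}$ viewed as the function $(d,\mathbf{y},\mathbf{x})\mapsto u(d;y_d,\mathbf{x})$ on $\mathcal{Z}$, that represents $\succsim$. Moreover, any such utility function $u$ is unique up to a positive affine transformation, i.e. if $u$ and $v$ are standard utilities both representing $\succsim$, then there are $a>0$ and $b\in\mathbb{R}$ with $v = au + b$.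
   Context: $\Delta(S)$ denotes the set of probability measures on a finite set $S$; $\delta_z$ is the Dirac measure at $z$. Elements of $\mathcal{Z}$ are written $(d,\mathbf{y},\mathbf{x})$ with $d\in\mathcal{D}$ (decision), $\mathbf{y}=(y_0,\ldots,y_{K-1})\in\mathcal{Y}^{\mathcal{D}}$ (potential outcomes) and $\mathbf{x}\in\mathcal{X}$ (covariates). On $\mathcal{Z}$, $D$, $Y(k)$ ($k\in\mathcal{D}$) and $\mathbf{X}$ denote the coordinate maps $(d,\mathbf{y},\mathbf{x})\mapsto d$, $y_k$, $\mathbf{x}$. A policy is a map $\pi:\mathcal{Y}^{\mathcal{D}}\times\mathcal{X}\to\Delta(\mathcal{D})$, and a state of nature is $P\in\Delta(\mathcal{Y}^{\mathcal{D}}\times\mathcal{X})$. The pair $(\pi,P)$ induces $P^\pi\in\Delta(\mathcal{Z})$ by $P^\pi(d,\mathbf{y},\mathbf{x})=\pi(d;\mathbf{y},\mathbf{x})P(\mathbf{y},\mathbf{x})$; every element of $\Delta(\mathcal{Z})$ is of this form. For $\tilde u:\mathcal{Z}\to\mathbb{R}$ the value is $V_P(\pi;\tilde u)=\sum_{(d,\mathbf{y},\mathbf{x})\in\mathcal{Z}}\tilde u(d;\mathbf{y},\mathbf{x})P^\pi(d,\mathbf{y},\mathbf{x})$. The relation $\succsim$ is represented by $\tilde u$ if for all $P^\pi,Q^\rho\in\Delta(\mathcal{Z})$: $P^\pi\succsim Q^\rho \iff V_P(\pi;\tilde u)\ge V_Q(\rho;\tilde u)$ (equivalently, for all $p,q\in\Delta(\mathcal{Z})$: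 $p\succsim q\iff \sum_z\tilde u(z)p(z)\ge\sum_z\tilde u(z)q(z)$). Write $p\succ q$ if $p\succsim q$ but not $q\succsim p$, and $p\sim q$ if $p\succsim q$ and $q\succsim p$. Mixtures are pointwise. Axioms: Completeness: for all $p,q\in\Delta(\mathcal{Z})$, $p\succsim q$ or $q\succsim p$. Transitivity: for all $p,q,r\in\Delta(\mathcal{Z})$, if $p\succsim q$ and $q\succsim r$ then $p\succsim r$. Independence: for all $p,q,r\in\Delta(\mathcal{Z})$ and $\alpha\in(0,1]$, if $p\succ q$ then $\alpha p+(1-\alpha)r\succ\alpha q+(1-\alpha)r$. Continuity: for all $p,q,r\in\Delta(\mathcal{Z})$, if $p\succ q\succ r$ then there exist $\alpha,\beta\in(0,1)$ with $\alpha p+(1-\alpha)r\succ q\succ\beta p+(1-\beta)r$. Irrelevance of Counterfactual Outcomes: for all $p,q\in\Delta(\mathcal{Z})$, $d\in\mathcal{D}$ and $\mathbf{x}\in\mathcal{X}$, if (i) $p(D=k)=q(D=k)=\delta_d(k)$ for all $k\in\mathcal{D}$, (ii) $p(\mathbf{X}=\mathbf{x}')=q(\mathbf{X}=\mathbf{x}')=\delta_{\mathbf{x}}(\mathbf{x}')$ for all $\mathbf{x}'\in\mathcal{X}$, and (iii) $p(Y(d)=y)=q(Y(d)=y)$ for all $y\in\mathcal{Y}$, then $p\sim q$. *)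

(* Defs.v *)
(* MathComp / MathComp-Analysis *)
From HB Require Import structures.
From mathcomp Require Import all_boot all_order all_algebra.
From mathcomp Require Import reals interval_inference.

Set Implicit Arguments.
Unset Strict Implicit.
Unset Printing Implicit Defensive.

Import Order.TTheory GRing.Theory Num.Theory.
Local Open Scope ring_scope.

Section FiniteDistributions.
Variables (R : realType) (S : finType).

(* A measure on a finite set is identified with its mass function. *)
Record fdist : Type := FDist {
  fdist_val :> {ffun S -> R};
  _ : [forall s, 0 <= fdist_val s] && (\sum_s fdist_val s == 1) }.

HB.instance Definition _ := [isSub for fdist_val].

Lemma fdist_ge0 (p : fdist) s : 0 <= p s.
Proof. by case: p => f /= /andP[/forallP]. Qed.

Lemma fdist_sum1 (p : fdist) : \sum_s p s = 1.
Proof. by case: p => f /= /andP[_ /eqP]. Qed.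

Lemma fdirac_subproof (z : S) (f := [ffun s => (s == z)%:R : R]) :
  [forall s, 0 <= f s] && (\sum_s f s == 1).
Proof.
apply/andP; split; first by apply/forallP => s; rewrite ffunE ler0n.
rewrite (bigD1 z) //= big1 ?addr0 => [|s /negbTE sz]; first by rewrite ffunE eqxx.
by rewrite ffunE sz.
Qed.

Definition fdirac (z : S) : fdist := FDist (fdirac_subproof z).

Lemma fmix_subproof (a : {i01 R}) (p q : fdist)
    (f := [ffun s => a%:num * p s + (1 - a%:num) * q s]) :
  [forall s, 0 <= f s] && (\sum_s f s == 1).
Proof.
apply/andP; split.
  apply/forallP => s; rewrite ffunE.
  by apply: addr_ge0; apply: mulr_ge0; rewrite ?fdist_ge0 // subr_ge0.
under eq_bigr do rewrite ffunE.
by rewrite big_split /= -!mulr_sumr !fdist_sum1 !mulr1 subrKC.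
Qed.

Definition fmix (a : {i01 R}) (p q : fdist) : fdist :=
  FDist (fmix_subproof a p q).

Definition prob (p : fdist) (A : pred S) : R := \sum_(s | A s) p s.

End FiniteDistributions.

Section DecisionProblem.
Variables (R : realType) (K M : nat) (X : finType).

Definition outcomes : finType := {ffun 'I_K -> 'I_M}.

(* The triple (d, y, x) is the left-nested pair ((d, y), x). *)
Definition Zspace : finType := ('I_K * outcomes * X)%type.

Definition decision (z : Zspace) : 'I_K := z.1.1.
Definition outcome (k : 'I_K) (z : Zspace) : 'I_M := z.1.2 k.
Definition covariate (z : Zspace) : X := z.2.

Definition policy : Type := outcomes * X -> fdist R 'I_K.
Definition state : Type := fdist R (outcomes * X)%type.

Lemma induced_subproof (P : state) (pi : policy)
    (f := [ffun z : Zspace => pi (z.1.2, z.2) z.1.1 * P (z.1.2, z.2)]) :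
  [forall z, 0 <= f z] && (\sum_z f z == 1).
Proof.
apply/andP; split.
  by apply/forallP => z; rewrite ffunE mulr_ge0 ?fdist_ge0.
under eq_bigr do rewrite ffunE.
apply/eqP; rewrite -[RHS](fdist_sum1 P).
transitivity (\sum_(w : outcomes * X) \sum_(d : 'I_K) pi w d * P w); last first.
  by apply: eq_bigr => w _; rewrite -mulr_suml fdist_sum1 mul1r.
rewrite exchange_big pair_big /=.
rewrite (reindex (fun t : 'I_K * (outcomes * X) => ((t.1, t.2.1), t.2.2))) /=.
  by apply: eq_bigr => -[d [y x]].
by exists (fun z => (z.1.1, (z.1.2, z.2))) => [[d [y x]]|[[d y] x]].
Qed.

(* P^pi(d, y, x) = pi(d; y, x) P(y, x) *)
Definition induced (P : state) (pi : policy) : fdist R Zspace :=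
  FDist (induced_subproof P pi).

Definition value (P : state) (pi : policy) (u : Zspace -> R) : R :=
  \sum_z u z * induced P pi z.

Definition standard (u : 'I_K * 'I_M * X -> R) : Zspace -> R :=
  fun z => u (decision z, outcome (decision z) z, covariate z).

Definition preference : Type := fdist R Zspace -> fdist R Zspace -> Prop.

Variable pref : preference.

Definition represents (u : Zspace -> R) : Prop :=
  forall (P : state) (pi : policy) (Q : state) (rho : policy),
    pref (induced P pi) (induced Q rho) <-> value P pi u >= value Q rho u.

Definition strict_pref (p q : fdist R Zspace) : Prop := pref p q /\ ~ pref q p.
Definition indifferent (p q : fdist R Zspace) : Prop := pref p q /\ pref q p.

Definition completeness : Prop := forall p q, pref p q \/ pref q p.

Definition transitivity : Prop :=
  forall p q r, pref p q -> pref q r -> pref p r.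

Definition independence : Prop :=
  forall p q r (a : {i01 R}), 0 < a%:num ->
    strict_pref p q -> strict_pref (fmix a p r) (fmix a q r).

Definition continuity : Prop :=
  forall p q r, strict_pref p q -> strict_pref q r ->
    exists a b : {i01 R},
      [/\ 0 < a%:num < 1, 0 < b%:num < 1,
          strict_pref (fmix a p r) q & strict_pref q (fmix b p r)].

Definition irrelevance_of_counterfactuals : Prop :=
  forall (p q : fdist R Zspace) (d : 'I_K) (x : X),
    (forall k, prob p [pred z | decision z == k] = fdirac R d k /\
               prob q [pred z | decision z == k] = fdirac R d k) ->
    (forall x', prob p [pred z | covariate z == x'] = fdirac R x x' /\
                prob q [pred z | covariate z == x'] = fdirac R x x') ->
    (forall y, prob p [pred z | outcome d z == y] =
               prob q [pred z | outcome d z == y]) ->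
    indifferent p q.

End DecisionProblem.

(* Main.v *)
(* The first four axioms are those of von Neumann and Morgenstern, so they give
   an expected-utility representation by some f on the point masses: f z is the
   weight at which the point mass at z is indifferent to a mixture of a best and
   a worst point mass. Irrelevance of Counterfactual Outcomes, applied to the
   point masses at (d, y, x) and (d, (y_d, ..., y_d), x), shows that f (d, y, x)
   depends only on d, y_d and x. Conversely, if p is concentrated on D = d and
   X = x, the expectation of a standard utility is a function of the law of Y(d)
   under p. Uniqueness: z is indifferent to a mixture of a maximizer and a
   minimizer of u, with a weight affine in u z, and v respects this
   indifference. *)
Require Import Defs.
From mathcomp Require Import all_boot all_order all_algebra.
From mathcomp Require Import boolp classical_sets reals interval_inference.
From mathcomp Require Import ring lra.
Set Implicit Arguments.
Unset Strict Implicit.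
Unset Printing Implicit Defensive.
Import Order.TTheory GRing.Theory Num.Theory.
Local Open Scope ring_scope.

(** * Mixtures, expectations and supports of finite distributions *)

Section Mixtures.
Variables (R : realType) (S : finType).
Implicit Types (p q r s : fdist R S) (a b c : R).

Lemma fdist_ext p q : (forall z, p z = q z) -> p = q.
Proof. by move=> pq; apply/val_inj/ffunP. Qed.

Lemma fdist_le1 p z : p z <= 1.
Proof.
rewrite -(fdist_sum1 p) (bigD1 z) //= lerDl.
by apply: sumr_ge0 => i _; exact: fdist_ge0.
Qed.

Lemma fdiracE (z z' : S) : fdirac R z z' = (z' == z)%:R.
Proof. by rewrite /= ffunE. Qed.

Lemma clamp01_subproof a : 0 <= Num.max 0 (Num.min 1 a) <= 1.
Proof. by rewrite le_max lexx ge_max ler01 ge_min lexx. Qed.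

Definition clamp01 a : {i01 R} :=
  Itv01 (proj1 (andP (clamp01_subproof a))) (proj2 (andP (clamp01_subproof a))).

Lemma clamp01K a : 0 <= a <= 1 -> (clamp01 a)%:num = a.
Proof.
by move=> /andP[a0 a1]; rewrite /= (min_idPr a1) (max_idPr a0).
Qed.

(* Meaningful for [0 <= a <= 1] only; other weights are clamped. *)
Definition mix a p q := fmix (clamp01 a) p q.

Lemma mix_num (a : {i01 R}) p q : mix a%:num p q = fmix a p q.
Proof.
apply: fdist_ext => z; rewrite !(ffunE _ z) clamp01K//.
by apply/andP; split.
Qed.

Lemma mixE a p q z : 0 <= a <= 1 -> mix a p q z = a * p z + (1 - a) * q z.
Proof. by move=> a01; rewrite /= ffunE clamp01K. Qed.

Lemma mix0 p q : mix 0 p q = q.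
Proof. by apply: fdist_ext => z; rewrite mixE ?lexx ?ler01//; ring. Qed.

Lemma mix1 p q : mix 1 p q = p.
Proof. by apply: fdist_ext => z; rewrite mixE ?lexx ?ler01//; ring. Qed.

Lemma mixxx a p : 0 <= a <= 1 -> mix a p p = p.
Proof. by move=> a01; apply: fdist_ext => z; rewrite mixE//; ring. Qed.

Lemma mixC a p q : 0 <= a <= 1 -> mix a p q = mix (1 - a) q p.
Proof. by move=> a01; apply: fdist_ext => z; rewrite !mixE ?a01//; [ring|lra]. Qed.

Lemma mixACA a b p q r : 0 <= a <= 1 -> 0 <= b <= 1 ->
  mix b (mix a p r) (mix a q r) = mix a (mix b p q) r.
Proof. by move=> a01 b01; apply: fdist_ext => z; rewrite !mixE//; ring. Qed.

Lemma mix_mix a b c p q : 0 <= a <= 1 -> 0 <= b <= 1 -> 0 <= c <= 1 ->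
  mix a (mix b p q) (mix c p q) = mix (a * b + (1 - a) * c) p q.
Proof.
move=> a01 b01 c01; apply: fdist_ext => z.
by rewrite !mixE//; [ring|nra].
Qed.

Definition expect (f : S -> R) p : R := \sum_z f z * p z.

Lemma expect_fmix f (a : {i01 R}) p q :
  expect f (fmix a p q) = a%:num * expect f p + (1 - a%:num) * expect f q.
Proof.
rewrite /expect !mulr_sumr -big_split /=; apply: eq_bigr => z _.
by rewrite ffunE; ring.
Qed.

Lemma expect_mix f a p q : 0 <= a <= 1 ->
  expect f (mix a p q) = a * expect f p + (1 - a) * expect f q.
Proof. by move=> a01; rewrite expect_fmix clamp01K. Qed.

Lemma expect_dirac f z : expect f (fdirac R z) = f z.
Proof.
rewrite /expect (bigD1 z) //= big1 ?addr0 => [|i /negbTE iz].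
  by rewrite ffunE eqxx mulr1.
by rewrite ffunE iz mulr0.
Qed.

Lemma expect01 f p : (forall z, 0 <= f z <= 1) -> 0 <= expect f p <= 1.
Proof.
move=> f01; apply/andP; split.
  apply: sumr_ge0 => z _; rewrite mulr_ge0 ?fdist_ge0//.
  by have /andP[] := f01 z.
rewrite -(fdist_sum1 p); apply: ler_sum => z _.
by rewrite ler_piMl ?fdist_ge0//; have /andP[] := f01 z.
Qed.

Lemma prob_dirac (z : S) (A : pred S) : prob (fdirac R z) A = (A z)%:R.
Proof.
rewrite /prob big_mkcond (bigD1 z) //= big1 ?addr0 => [|i /negbTE iz].
  by rewrite ffunE eqxx; case: (A z).
by rewrite ffunE iz; case: ifP.
Qed.

Lemma prob_eq0 p (A : pred S) : prob p A = 0 -> forall z, A z -> p z = 0.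
Proof.
move=> /eqP; rewrite /prob psumr_eq0 => [/allP pA0 z Az|z _]; last exact: fdist_ge0.
by have := pA0 z (mem_index_enum z); rewrite Az => /eqP.
Qed.

Lemma fdist_supp p : exists z, p z != 0.
Proof.
apply/existsP; apply: contraT; rewrite negb_exists => /forallP p0.
have := fdist_sum1 p; rewrite big1 => [/eqP|z _]; first by rewrite eq_sym oner_eq0.
by apply/eqP; have := p0 z; rewrite negbK.
Qed.

Lemma fdist_eq1 p z : p z = 1 -> p = fdirac R z.
Proof.
move=> pz1; apply: fdist_ext => i; rewrite fdiracE.
have [->//|iz] := eqVneq i z.
have : \sum_(j | j != z) p j = 0.
  by have := fdist_sum1 p; rewrite (bigD1 z) //= pz1; lra.
by move/prob_eq0; apply.
Qed.

(** The witness [q] is [p] conditioned on avoiding [z]: the mass at [z] is dropped and the rest is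
    divided by [1 - p z]. The support clause makes the support shrink when [p z] is nonzero. *)
Lemma fdist_split p z : p z != 1 ->
  exists q, p = mix (p z) (fdirac R z) q /\ forall i, (q i != 0) = (i != z) && (p i != 0).
Proof.
move=> pz1; have p01 : 0 <= p z <= 1 by rewrite fdist_ge0 fdist_le1.
have c0 : 0 < 1 - p z by rewrite subr_gt0 lt_neqAle pz1 fdist_le1.
pose f := [ffun i => (i != z)%:R * p i / (1 - p z)].
have fP : [forall i, 0 <= f i] && (\sum_i f i == 1).
  apply/andP; split.
    apply/forallP => i; rewrite ffunE.
    by rewrite divr_ge0 ?(ltW c0)// mulr_ge0 ?fdist_ge0.
  rewrite (bigD1 z) //= ffunE eqxx !mul0r add0r.
  under eq_bigr => i iz do rewrite ffunE iz mul1r.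
  rewrite -mulr_suml; have := fdist_sum1 p; rewrite (bigD1 z) //= => /(canRL (addKr _)) ->.
  by rewrite addrC divff// gt_eqF.
exists (FDist fP); split.
  apply: fdist_ext => i; rewrite mixE// fdiracE [FDist fP i]/= ffunE.
  have [->|iz] := eqVneq i z; first by rewrite /=; ring.
  by rewrite /=; field; rewrite gt_eqF.
move=> i; rewrite [FDist fP i]/= ffunE.
have [_|_] := eqVneq i z; first by rewrite !mul0r eqxx.
by rewrite mul1r mulf_eq0 invr_eq0 (gt_eqF c0) orbF.
Qed.

(** Strong induction on the size of the support: one support point at a time is split off until a
    point mass remains. Claims about all distributions thus reduce to binary mixtures. *)
Lemma fdist_ind (Q : fdist R S -> Prop) :
  (forall z, Q (fdirac R z)) ->
  (forall a z q, 0 <= a <= 1 -> Q q -> Q (mix a (fdirac R z) q)) ->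
  forall p, Q p.
Proof.
move=> Qd Qm p; have [n] := ubnP #|[pred z | p z != 0]|.
elim: n => // n IH in p *; rewrite ltnS => pn.
have [z pz0] := fdist_supp p.
have [pz1|pz1] := eqVneq (p z) 1; first by rewrite (fdist_eq1 pz1).
have [q [pE qi]] := fdist_split pz1; rewrite pE.
apply: Qm; first by rewrite fdist_ge0 fdist_le1.
apply/IH/(leq_trans _ pn); rewrite [leqRHS](cardD1 z) !inE pz0 ltnS.
by apply/eq_leq/eq_card => i; rewrite !inE qi.
Qed.

End Mixtures.

(** Minima are obtained by passing the reversed relation. *)
Lemma seq_max (T : eqType) (P : T -> T -> Prop) (x : T) (t : seq T) :
  (forall x y, P x y \/ P y x) -> (forall x y z, P x y -> P y z -> P x z) ->
  exists m, forall y, y \in x :: t -> P m y.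
Proof.
move=> Pt Ptr; elim: t => [|y t [m Hm]].
  by exists x => y; rewrite inE => /eqP->; case: (Pt x x).
have {}Hm z : z \in x :: t -> P m z by exact: Hm.
case: (Pt m y) => my.
  by exists m => z; rewrite !inE orbCA => /orP[/eqP->//|zt]; apply: Hm; rewrite inE.
exists y => z; rewrite !inE orbCA => /orP[/eqP->|zt]; first by case: (Pt y y).
by apply: Ptr my _; apply: Hm; rewrite inE.
Qed.

(** * The von Neumann-Morgenstern representation *)

Section VonNeumannMorgenstern.
Variables (R : realType) (S : finType) (pref : fdist R S -> fdist R S -> Prop).
Implicit Types (p q r s : fdist R S) (a b : R).

Local Notation "p >~ q" := (pref p q) (at level 70).
Local Notation "p >> q" := (pref p q /\ ~ pref q p) (at level 70).
Local Notation "p ~~~ q" := (pref p q /\ pref q p) (at level 70).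

Hypothesis cpl : forall p q, p >~ q \/ q >~ p.
Hypothesis trans : forall p q r, p >~ q -> q >~ r -> p >~ r.
Hypothesis indep : forall p q r (a : {i01 R}), 0 < a%:num ->
  p >> q -> fmix a p r >> fmix a q r.
Hypothesis cont : forall p q r, p >> q -> q >> r ->
  exists a b : {i01 R}, [/\ 0 < a%:num < 1, 0 < b%:num < 1,
    fmix a p r >> q & q >> fmix b p r].

Lemma strict_weak_trans p q r : p >> q -> q >~ r -> p >> r.
Proof. by move=> [pq nqp] qr; split=> [|rp]; [exact: trans qr | exact/nqp/(trans qr)]. Qed.

Lemma weak_strict_trans p q r : p >~ q -> q >> r -> p >> r.
Proof. by move=> pq [qr nrq]; split=> [|rp]; [exact: trans qr | exact/nrq/(trans rp)]. Qed.

Lemma notP_pref p q : ~ (p >> q) -> q >~ p.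
Proof. by move=> npq; case: (cpl q p) => // pq; apply: contrapT => nqp; exact: npq. Qed.

Lemma strict_mix a p q r : 0 < a <= 1 -> p >> q -> mix a p r >> mix a q r.
Proof. by move=> /andP[a0 a1]; apply: indep; rewrite clamp01K ?(ltW a0). Qed.

Lemma strict_mixl a p q : 0 < a <= 1 -> p >> q -> mix a p q >> q.
Proof.
move=> /andP[a0 a1] pq; rewrite -{2 3}(@mixxx _ _ a q) ?(ltW a0)//.
by apply: strict_mix; rewrite ?a0.
Qed.

Lemma strict_mixr a p q : 0 <= a < 1 -> p >> q -> p >> mix a p q.
Proof.
move=> a01 pq; have a01' : 0 <= a <= 1 by lra.
rewrite (mixC p q a01') -{1 4}(@mixxx _ _ (1 - a) p); last lra.
by apply: strict_mix => //; lra.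
Qed.

(** The mixture of weight [a] is itself a mixture, with weight [a / b], of the one of weight [b] and
    [q]; Independence then applies twice. *)
Lemma strict_mix_lt a b p q : 0 <= a -> a < b -> b <= 1 -> p >> q ->
  mix b p q >> mix a p q.
Proof.
move=> a0 ab b1 pq; have b0 : 0 < b by exact: le_lt_trans ab.
have e : mix a p q = mix (a / b) (mix b p q) q.
  have ab01 : 0 <= a / b <= 1 by rewrite divr_ge0 ?(ltW b0)//= ler_pdivrMr// mul1r ltW.
  have ab' : 0 <= a <= 1 by lra.
  have b01 : 0 <= b <= 1 by lra.
  by apply: fdist_ext => z; rewrite !mixE//; field; rewrite gt_eqF.
rewrite e; apply: strict_mixr; last by apply: strict_mixl; rewrite ?b0.
by rewrite divr_ge0 ?(ltW b0)//= ltr_pdivrMr// mul1r.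
Qed.

Lemma mix_cont p q r : p >> q -> q >> r ->
  (exists2 a, 0 < a < 1 & mix a p r >> q) /\ (exists2 a, 0 < a < 1 & q >> mix a p r).
Proof.
move=> pq qr; have [a [b [a01 b01 ? ?]]] := cont pq qr.
by split; [exists a%:num | exists b%:num]; rewrite ?mix_num.
Qed.

(* Independence is assumed for strict preference only. If mixing with [r]
   separated [p ~ q], any [s] not indifferent to [p] would contradict
   Continuity, because the perturbations of [p] and [q] towards [s] are strictly
   ordered with respect to both [p] and [q], however small they are. *)
Lemma equiv_mix_nstrict a p q r : 0 <= a <= 1 -> p ~~~ q ->
  ~ (mix a p r >> mix a q r).
Proof.
move=> a01 [pq qp] H; have [a0|a0] := eqVneq a 0.
  by move: H; rewrite a0 !mix0 => -[].
have a01' : 0 < a <= 1 by rewrite lt_neqAle eq_sym a0.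
have [[s sp]|ns] := EM (exists s, s >> p).
  have [_ [b b01]] := mix_cont (strict_mix r a01' sp) H.
  have b01' : 0 <= b <= 1 by lra.
  rewrite mixACA//; case=> _; apply; apply: (proj1 (strict_mix _ a01' _)).
  apply: strict_weak_trans qp; apply: strict_mixl; first lra.
  exact: strict_weak_trans pq.
have [[s ps]|ns'] := EM (exists s, p >> s).
  have qs := weak_strict_trans qp ps.
  have [[b b01 Hb] _] := mix_cont H (strict_mix r a01' qs).
  have b01' : 0 <= b <= 1 by lra.
  move: Hb; rewrite mixACA//; case=> _; apply; apply: (proj1 (strict_mix _ a01' _)).
  by apply: weak_strict_trans qp _; apply: strict_mixr => //; lra.
case: H => _; apply; apply: (@trans _ p).
  by apply: notP_pref => H; apply: ns'; exists (mix a q r).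
by apply: notP_pref => H; apply: ns; exists (mix a p r).
Qed.

Lemma equiv_mixl a p q r : 0 <= a <= 1 -> p ~~~ q -> mix a p r ~~~ mix a q r.
Proof.
move=> a01 pq; split; apply: notP_pref; apply: equiv_mix_nstrict => //.
by case: pq.
Qed.

Lemma equiv_mix a p q p' q' : 0 <= a <= 1 -> p ~~~ p' -> q ~~~ q' ->
  mix a p q ~~~ mix a p' q'.
Proof.
move=> a01 pp' qq'.
have [H1 H2] := equiv_mixl q a01 pp'.
have a01' : 0 <= 1 - a <= 1 by lra.
have [] := equiv_mixl p' a01' qq'; rewrite -!mixC// => H3 H4.
by split; [exact: trans H3|exact: trans H2].
Qed.

(** The weight is the supremum of those whose mixture is weakly worse than [p]; Continuity rules out
    a strict comparison there in either direction. *)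
Lemma calibration p (b w : fdist R S) : b >> w -> b >~ p -> p >~ w ->
  exists a, 0 <= a <= 1 /\ p ~~~ mix a b w.
Proof.
move=> bw bp pw.
have [pb|npb] := EM (p >~ b); first by exists 1; rewrite ler01 lexx mix1.
have [wp|nwp] := EM (w >~ p); first by exists 0; rewrite ler01 lexx mix0.
pose A : set R := [set a | 0 <= a <= 1 /\ p >~ mix a b w]%classic.
have A0 : A 0 by split; rewrite ?ler01 ?lexx ?mix0.
have ubA : ubound A 1 by move=> a [/andP[]].
have hsA : has_sup A by split; [exists 0 | exists 1].
have le_sA a : A a -> a <= sup A by move=> Aa; apply: ub_le_sup => //; exists 1.
have s0 : 0 <= sup A by exact: le_sA.
have s1 : sup A <= 1 by apply: ge_sup => //; exists 0.
have s01 : 0 <= sup A <= 1 by rewrite s0.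
exists (sup A); split => //; split; apply: notP_pref => H.
(* Were the mixture at [sup A] strictly better than [p], so would be the one at the smaller weight
   [c * sup A]; but [A] has an element above that weight. *)
- have s_gt0 : 0 < sup A.
    rewrite lt_neqAle s0 andbT; apply/eqP => e.
    by case: H => _; apply; rewrite -e mix0.
  have [[c c01 Hc] _] := mix_cont H (conj pw nwp).
  have eps0 : 0 < sup A - c * sup A by rewrite subr_gt0 gtr_pMl//; lra.
  have [a [/andP[a0 a1] pa] ca] := sup_adherent eps0 hsA.
  have e : mix c (mix (sup A) b w) w = mix (c * sup A) b w.
    rewrite -{2}[w](mix0 b) mix_mix ?mulr0 ?addr0//; [lra|by rewrite lexx ler01].
  rewrite e in Hc; case: Hc => Hc; apply; apply: (trans pa).
  by apply: (proj1 (strict_mix_lt _ _ _ bw)) => //; [nra|lra].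
(* Were it strictly worse, the larger weight [c + (1 - c) * sup A] would still lie in [A]. *)
- have [_ [c c01 Hc]] := mix_cont (conj bp npb) H.
  have s_lt1 : sup A < 1.
    rewrite lt_neqAle s1 andbT; apply/eqP => e.
    by case: H => _; apply; rewrite e mix1.
  have e : mix c b (mix (sup A) b w) = mix (c + (1 - c) * sup A) b w.
    rewrite -{1}[b](mix1 _ w) mix_mix ?mulr1//; [lra|by rewrite lexx ler01].
  rewrite e in Hc; have /le_sA : A (c + (1 - c) * sup A).
    by split; [nra | case: Hc].
  by nra.
Qed.

Lemma expected_utility :
  exists f : S -> R, forall p q, p >~ q <-> expect f q <= expect f p.
Proof.
have [x _|S0] := pickP S; last first.
  (* An empty set carries no distribution, since the masses would sum to 0. *)
  exists (fun=> 0) => p; have := fdist_sum1 p; rewrite big1 => [/eqP|z].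
    by rewrite eq_sym oner_eq0.
  by have := S0 z.
have dtr (i j k : S) : fdirac R i >~ fdirac R j -> fdirac R j >~ fdirac R k ->
  fdirac R i >~ fdirac R k by exact: trans.
have [b Hb] := @seq_max S (fun x y => fdirac R x >~ fdirac R y) x (enum S)
  (fun _ _ => cpl _ _) dtr.
have [w Hw] := @seq_max S (fun x y => fdirac R y >~ fdirac R x) x (enum S)
  (fun _ _ => cpl _ _) (fun _ _ _ yx zy => dtr _ _ _ zy yx).
have {}Hb z : fdirac R b >~ fdirac R z by apply: Hb; rewrite inE mem_enum orbT.
have {}Hw z : fdirac R z >~ fdirac R w by apply: Hw; rewrite inE mem_enum orbT.
(* Calibration passes from point masses to all distributions: mixing preserves indifference, and the
   weights combine exactly as expectations do. *)
have sandwich f : (forall z, 0 <= f z <= 1 /\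
      fdirac R z ~~~ mix (f z) (fdirac R b) (fdirac R w)) ->
    forall p, p ~~~ mix (expect f p) (fdirac R b) (fdirac R w).
  move=> Hf; have f01 z : 0 <= f z <= 1 by case: (Hf z).
  apply: fdist_ind => [z|a z q a01 IH]; first by rewrite expect_dirac; case: (Hf z).
  rewrite expect_mix// expect_dirac -mix_mix ?expect01//.
  by apply: equiv_mix => //; case: (Hf z).
(* If the best and worst point masses are indifferent, everything is indifferent to [w], and a
   constant utility represents the relation. *)
have [wb|nwb] := EM (fdirac R w >~ fdirac R b).
  exists (fun=> 0) => p q.
  have e0 r : expect (fun=> 0) r = 0 :> R by apply: big1 => z _; rewrite mul0r.
  have all_w r : r ~~~ fdirac R w.
    rewrite -(mix0 (fdirac R b) (fdirac R w)) -(e0 r); apply: sandwich => z.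
    rewrite ler01 lexx mix0; split => //; split => //.
    exact: trans wb (Hb z).
  rewrite !e0 lexx; split => // _.
  by case: (all_w p) (all_w q) => pw _ [_ wq]; exact: trans wq.
have [f Hf] : exists f : S -> R, forall z, 0 <= f z <= 1 /\
    fdirac R z ~~~ mix (f z) (fdirac R b) (fdirac R w).
  exact: (@fin_all_exists _ (fun=> R) _
    (fun z => calibration (conj (Hb w) nwb) (Hb z) (Hw z))).
have f01 z : 0 <= f z <= 1 by case: (Hf z).
(* On the segment from [w] to [b] preference is strictly monotone in the weight. This settles
   unequal expectations; equal ones calibrate to the same mixture. *)
have lt_strict p q : expect f p < expect f q -> q >> p.
  move=> pq; have /andP[p0 p1] := expect01 p f01; have /andP[q0 q1] := expect01 q f01.
  have [_ ep] := sandwich _ Hf p; have [eq _] := sandwich _ Hf q.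
  apply: weak_strict_trans eq _; apply: strict_weak_trans ep.
  by apply: strict_mix_lt.
exists f => p q; split=> [pq|].
  by rewrite leNgt; apply/negP => /lt_strict[].
rewrite le_eqVlt => /orP[/eqP e|/lt_strict[]//].
have [ep _] := sandwich _ Hf p; have [_ eq] := sandwich _ Hf q.
by apply: trans eq; rewrite e.
Qed.

End VonNeumannMorgenstern.

(** * Consequences of an expected-utility representation: axioms and uniqueness *)

Section ExpectedUtility.
Variables (R : realType) (S : finType) (pref : fdist R S -> fdist R S -> Prop).
Variable f : S -> R.
Implicit Types p q r : fdist R S.

Local Notation "p >> q" := (pref p q /\ ~ pref q p) (at level 70).

Hypothesis prefE : forall p q, pref p q <-> expect f q <= expect f p.

Lemma strictE p q : p >> q <-> expect f q < expect f p.
Proof.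
split=> [[_ nqp]|pq]; first by rewrite ltNge; apply/negP => /prefE.
by split; [exact/prefE/ltW | move/prefE; rewrite leNgt pq].
Qed.

Lemma expect_independence p q r (a : {i01 R}) : 0 < a%:num ->
  p >> q -> fmix a p r >> fmix a q r.
Proof. by move=> a0 /strictE pq; apply/strictE; rewrite !expect_fmix ltrD2r ltr_pM2l. Qed.

Lemma expect_continuity p q r : p >> q -> q >> r ->
  exists a b : {i01 R}, [/\ 0 < a%:num < 1, 0 < b%:num < 1,
    fmix a p r >> q & q >> fmix b p r].
Proof.
move=> /strictE pq /strictE qr.
have pr : 0 < expect f p - expect f r by rewrite subr_gt0; exact: lt_trans pq.
(* At weight [t] the mixture of [p] and [r] has the expectation of [q]; the witnesses are the
   midpoints of [t, 1] and [0, t]. *)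
pose t := (expect f q - expect f r) / (expect f p - expect f r).
have tE : t * (expect f p - expect f r) = expect f q - expect f r.
  by rewrite /t divfK// gt_eqF.
have t0 : 0 < t by rewrite /t divr_gt0 // subr_gt0.
have t1 : t < 1 by rewrite /t ltr_pdivrMr// mul1r ltrD2r.
exists (clamp01 ((1 + t) / 2)), (clamp01 (t / 2)).
have a01 : 0 <= (1 + t) / 2 <= 1 by lra.
have b01 : 0 <= t / 2 <= 1 by lra.
rewrite !clamp01K//; split; [lra|lra|apply/strictE|apply/strictE].
  by rewrite expect_fmix clamp01K//; nra.
by rewrite expect_fmix clamp01K//; nra.
Qed.

Lemma expected_utility_unique g :
  (forall p q, pref p q <-> expect g q <= expect g p) ->
  exists a b : R, 0 < a /\ forall z, g z = a * f z + b.
Proof.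
move=> prefEg; have [x _|S0] := pickP S; last first.
  by exists 1, 0; split => // z; have := S0 z.
(* Equal expectations mean indifference, a property of the relation that [f] and [g] share. *)
have fg p q : expect f p = expect f q -> expect g p = expect g q.
  by move=> e; apply/le_anti/andP; split; apply/prefEg/prefE; rewrite e.
have [M HM] := @seq_max S (fun i j => f j <= f i) x (enum S)
  (fun i j => orP (le_total (f j) (f i))) (fun i j k ij jk => le_trans jk ij).
have [m Hm] := @seq_max S (fun i j => f i <= f j) x (enum S)
  (fun i j => orP (le_total (f i) (f j))) (fun i j k ij jk => le_trans ij jk).
have {}HM z : f z <= f M by apply: HM; rewrite inE mem_enum orbT.
have {}Hm z : f m <= f z by apply: Hm; rewrite inE mem_enum orbT.
(* If [f] is constant then so is [g]; the slope is arbitrary, and 1 is taken. *)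
have [Mm|mM] := leP (f M) (f m).
  exists 1, (g m - f m); split => // z.
  have := fg (fdirac R z) (fdirac R m); rewrite !expect_dirac => ->; last first.
    by apply/le_anti; rewrite Hm (le_trans (HM z)).
  suff -> : f z = f m by ring.
  by apply/le_anti; rewrite Hm (le_trans (HM z)).
have gmM : g m < g M.
  rewrite ltNge; apply/negP => gMm; move: mM; rewrite ltNge => /negP; apply.
  by rewrite -!(expect_dirac f) -prefE prefEg !expect_dirac.
have d0 : f M - f m != 0 by rewrite subr_eq0 gt_eqF.
(* The affine map sending [f m] to [g m] and [f M] to [g M]. *)
exists ((g M - g m) / (f M - f m)), (g m - (g M - g m) / (f M - f m) * f m).
split=> [|z]; first by rewrite divr_gt0 ?subr_gt0.
pose t := (f z - f m) / (f M - f m).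
have t01 : 0 <= t <= 1.
  rewrite /t ler_pdivrMr ?subr_gt0// mul1r lerD2r HM andbT.
  by rewrite divr_ge0// subr_ge0// ltW.
have := fg (fdirac R z) (mix t (fdirac R M) (fdirac R m)).
rewrite !expect_mix// !expect_dirac => ->; first by rewrite /t; field.
by rewrite /t; field.
Qed.

End ExpectedUtility.

(** * Standard utilities and counterfactual outcomes *)

Section StandardUtility.
Variables (R : realType) (K M : nat) (X : finType).
Variable pref : preference R K M X.
Hypothesis K_gt0 : (0 < K)%N.

Local Notation Z := (Zspace K M X).

(** Disintegration: [P] is the marginal law of outcomes and covariates, and [pi] the conditional law
    of the decision. *)
Lemma induced_surj (p : fdist R Z) :
  exists (P : state R K M X) (pi : policy R K M X), induced P pi = p.
Proof.
pose f := [ffun w : outcomes K M * X => \sum_d p (d, w.1, w.2)].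
have fP : [forall w, 0 <= f w] && (\sum_w f w == 1).
  apply/andP; split.
    by apply/forallP => w; rewrite ffunE sumr_ge0// => d _; exact: fdist_ge0.
  under eq_bigr do rewrite ffunE.
  apply/eqP; rewrite -(fdist_sum1 p) exchange_big pair_big /=.
  rewrite [RHS](reindex (fun t : 'I_K * (outcomes K M * X) => ((t.1, t.2.1), t.2.2))) //=.
  by exists (fun z => (z.1.1, (z.1.2, z.2))) => [[d [y x]]|[[d y] x]].
have /fin_all_exists[pi piE] w : exists q : fdist R 'I_K,
    forall d, q d * f w = p (d, w.1, w.2).
  have [fw0|fw0] := eqVneq (f w) 0.
    (* On a null pair [w] the policy is free; decision 0 serves as default. *)
    exists (fdirac R (Ordinal K_gt0)) => d; rewrite fw0 mulr0.
    move: fw0; rewrite ffunE => /eqP; rewrite psumr_eq0 => [/allP/(_ d)|? _].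
      by rewrite mem_index_enum => /(_ isT)/eqP.
    exact: fdist_ge0.
  have qP : let q := [ffun d => p (d, w.1, w.2) / f w] in
      [forall d, 0 <= q d] && (\sum_d q d == 1).
    apply/andP; split.
      apply/forallP => d; rewrite ffunE divr_ge0 ?fdist_ge0//.
      by case/andP: fP => /forallP.
    under eq_bigr do rewrite ffunE.
    by rewrite -mulr_suml; move: fw0; rewrite [f w]ffunE => fw0; rewrite divff.
  by exists (FDist qP) => d; rewrite /= ffunE divfK.
exists (FDist fP), pi; apply: fdist_ext => -[[d y] x].
by rewrite /= ffunE /= piE.
Qed.

Lemma representsE (u : Z -> R) : represents pref u <->
  forall p q, pref p q <-> expect u q <= expect u p.
Proof.
split=> [H p q|H P pi Q rho]; last exact: H.
have [P [pi <-]] := induced_surj p; have [Q [rho <-]] := induced_surj q.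
exact: H.
Qed.

Lemma expect_standard (u : 'I_K * 'I_M * X -> R) (p : fdist R Z) d x :
  (forall k, prob p [pred z | decision z == k] = fdirac R d k) ->
  (forall x', prob p [pred z | covariate z == x'] = fdirac R x x') ->
  expect (standard u) p =
    \sum_y u (d, y, x) * prob p [pred z | outcome d z == y].
Proof.
move=> pd px.
(* Points with another decision or covariate have mass zero, so [d] and [x] may be put into the
   utility everywhere; the sum is then grouped by the value of Y(d). *)
transitivity (\sum_z u (d, outcome d z, x) * p z).
  apply: eq_bigr => z _; rewrite /standard.
  have [<-|dz] := eqVneq (decision z) d; last first.
    have := pd (decision z); rewrite fdiracE (negbTE dz) => /prob_eq0 ->.
      by rewrite !mulr0.
    by rewrite /= eqxx.
  have [<-//|xz] := eqVneq (covariate z) x.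
  have := px (covariate z); rewrite fdiracE (negbTE xz) => /prob_eq0 ->.
    by rewrite !mulr0.
  by rewrite /= eqxx.
rewrite (partition_big (outcome d) predT) //=; apply: eq_bigr => y _.
by rewrite /prob mulr_sumr; apply: eq_bigr => z /eqP ->.
Qed.

Lemma represents_axioms (u : 'I_K * 'I_M * X -> R) :
  represents pref (standard u) ->
  [/\ completeness pref, transitivity pref, independence pref,
      continuity pref & irrelevance_of_counterfactuals pref].
Proof.
move=> /representsE H; split.
- by move=> p q; have /orP[/H|/H] := le_total (expect (standard u) p)
    (expect (standard u) q); [right|left].
- by move=> p q r /H pq /H qr; apply/H/(le_trans qr).
- by move=> p q r a; exact: (expect_independence H).
- by move=> p q r; exact: (expect_continuity H).
move=> p q d x hd hx hy.
have e : expect (standard u) p = expect (standard u) q.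
  rewrite (expect_standard u (fun k => proj1 (hd k)) (fun x' => proj1 (hx x'))).
  rewrite (expect_standard u (fun k => proj2 (hd k)) (fun x' => proj2 (hx x'))).
  by apply: eq_bigr => y _; rewrite hy.
by split; apply/H; rewrite e.
Qed.

(** A section of the map from (d, y, x) to (d, y_d, x). It picks a representative of each triple and
    carries uniqueness on [Z] back to triples. *)
Definition constant_outcome (t : 'I_K * 'I_M * X) : Z :=
  (t.1.1, [ffun=> t.1.2], t.2).

Lemma standard_constant (u : 'I_K * 'I_M * X -> R) t :
  standard u (constant_outcome t) = u t.
Proof. by case: t => -[d y] x; rewrite /standard /outcome /= ffunE. Qed.

Lemma axioms_represents :
  completeness pref -> transitivity pref -> independence pref ->
  continuity pref -> irrelevance_of_counterfactuals pref ->
  exists u : 'I_K * 'I_M * X -> R, represents pref (standard u).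
Proof.
move=> cpl tr indep cont irr.
have [f Hf] := expected_utility cpl tr indep cont.
exists (f \o constant_outcome).
have fE : standard (f \o constant_outcome) = f.
  apply: funext => z; rewrite /standard /=.
  set z' := constant_outcome _.
  (* Both points share the decision, the covariate and the outcome of that decision, so the axiom
     applies to their point masses. *)
  have [/Hf zz' /Hf z'z] : indifferent pref (fdirac R z') (fdirac R z).
    apply: (irr _ _ (decision z) (covariate z)) => k.
    - by rewrite !prob_dirac fdiracE eq_sym.
    - by rewrite !prob_dirac fdiracE eq_sym.
    - by rewrite !prob_dirac /outcome /= ffunE.
  by move: zz' z'z; rewrite !expect_dirac => ? ?; apply/le_anti/andP.
by apply/representsE; rewrite fE.
Qed.

End StandardUtility.

Theorem theorem2 (R : realType) (K M : nat) (hK : (2 <= K)%N) (hM : (2 <= M)%N)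
    (X : finType) (pref : preference R K M X) :
  ([/\ completeness pref, transitivity pref, independence pref,
       continuity pref & irrelevance_of_counterfactuals pref]
   <-> exists u : 'I_K * 'I_M * X -> R, represents pref (standard u))
  /\
  (forall u v : 'I_K * 'I_M * X -> R,
     represents pref (standard u) -> represents pref (standard v) ->
     exists a b : R, 0 < a /\ forall t, v t = a * u t + b).
Proof.
have K_gt0 : (0 < K)%N by exact: ltnW.
split; first split=> [[]|[u]].
- exact: axioms_represents.
- exact: represents_axioms.
move=> u v /(representsE _ K_gt0) Hu /(representsE _ K_gt0) Hv.
have [a [b [a0 vE]]] := expected_utility_unique Hu Hv.
by exists a, b; split => // t; rewrite -!standard_constant.
Qed.
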